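(* Let $\theta:(0,\infty)\to\mathbb{R}$ be defined by $\theta(x)=1-\sigma(x)$, where $$\sigma(x)=12x\ln\frac{\Gamma(x+1)}{\sqrt{2\pi x}\,(x/e)^{x}},\qquad x>0.$$ Then the derivatives of all orders of $\theta$ satisfy $$(-1)^{n}\theta^{(n)}(x)>0\qquad\text{for all } x>0 \text{ and all } n=0,1,2,\ldots$$
   Context: $\Gamma$ denotes the Euler gamma function and $\ln$ the natural logarithm. $\theta^{(n)}$ denotes the $n$-th derivative of $\theta$, with $\theta^{(0)}=\theta$. The function $\sigma$ is the remainder in Stirling's formula, i.e. it is determined by $\Gamma(x+1)=\sqrt{2\pi x}\,(x/e)^{x}e^{\sigma(x)/(12x)}$ for $x>0$. *)

(* Defs.v *)
From HB Require Import structures.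
From mathcomp Require Import all_boot all_order all_algebra.
From mathcomp Require Import all_classical all_reals all_analysis.
Set Implicit Arguments.
Unset Strict Implicit.
Unset Printing Implicit Defensive.
Import Order.TTheory GRing.Theory Num.Theory.
Import numFieldNormedType.Exports.
Local Open Scope classical_set_scope.
Local Open Scope ring_scope.

(* Euler's integral, which converges for x > 0; [\int] on real-valued integrands
   is the finite part of the Lebesgue integral, so the value for x <= 0, where
   the integral diverges, is not meaningful. *)
Definition Gamma (R : realType) (x : R) : R :=
  \int[lebesgue_measure]_(t in `]0, +oo[) (t `^ (x - 1) * expR (- t)).

(* sigma and theta are meant on ]0, +oo[ only. This set is open, so the
   derivatives of theta at x > 0 do not depend on the values outside it. *)
Definition sigma (R : realType) (x : R) : R :=
  12 * x * ln (Gamma (x + 1) / (Num.sqrt (2 * pi * x) * (x / expR 1) `^ x)).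

Definition theta (R : realType) (x : R) : R := 1 - sigma x.

(* Main.v *)
Require Import Defs.
From HB Require Import structures.
From mathcomp Require Import all_boot all_order all_algebra.
From mathcomp Require Import all_classical all_reals all_analysis.
From mathcomp Require Import measurable_realfun ring lra.
Import Order.TTheory GRing.Theory Num.Theory.
Import numFieldNormedType.Exports.
Local Open Scope classical_set_scope.
Local Open Scope ring_scope.

(** The function [theta] is the Laplace transform of a positive function, and
    differentiating a Laplace transform [n] times multiplies the transformed
    function by [(- t) ^+ n].

    Let [phi t = (1 / (e^t - 1) - 1 / t + 1 / 2) / t]. Binet's formula
    ([ln_stirling_ratio]) states that the remainder [sigma x / (12 x)] in
    Stirling's formula is the Laplace transform of [phi]. Since [phi] tends to
    [1 / 12] at 0, an integration by parts ([laplace_binet_kernel_parts]) turns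
    this into [theta x = laplace (- 12 phi') x] ([theta_laplace]). The decisive
    point is that [phi] is strictly decreasing ([dbinet_kernel_lt0]): this is
    an inequality between exponential polynomials, proved by repeated
    differentiation.

    Binet's formula itself is a uniqueness statement. The remainder and the
    transform of [phi] satisfy the same difference equation
    [f x - f (x + 1) = (x + 1 / 2) (ln (x + 1) - ln x) - 1]: for the remainder
    this is [Gamma (x + 1) = x Gamma x] ([ln_stirling_ratioB]); for the
    transform both sides are determined by their second derivatives, which are
    rational functions ([laplace_binet_kernelB]). Both solutions tend to 0
    along [x + n]: the transform by dominated convergence, the remainder by
    Stirling's formula ([cvg_stirling_ratio]). The latter is obtained by
    Laplace's method, that is, dominated convergence towards the Gaussian
    integral after centering Euler's integral at its maximum and rescaling. *)

(** * Differentiation rules for explicit functions *)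

Section derivatives.
Context {R : realType}.
Implicit Types (f g : R -> R) (x a b c : R).

Lemma is_derive_fun_cst c x : is_derive x 1 (fun=> c) 0.
Proof. exact: is_derive_cst. Qed.

Lemma is_derive_fun_id x : is_derive x 1 (fun y => y) 1.
Proof. exact: is_derive_id. Qed.

Lemma is_derive_funD f g x a b : is_derive x 1 f a -> is_derive x 1 g b ->
  is_derive x 1 (fun y => f y + g y) (a + b).
Proof. by move=> fa gb; exact: is_deriveD. Qed.

Lemma is_derive_funN f x a : is_derive x 1 f a ->
  is_derive x 1 (fun y => - f y) (- a).
Proof. by move=> fa; exact: is_deriveN. Qed.

Lemma is_derive_funM f g x a b : is_derive x 1 f a -> is_derive x 1 g b ->
  is_derive x 1 (fun y => f y * g y) (f x * b + g x * a).
Proof. by move=> fa gb; exact: is_deriveM. Qed.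

Lemma is_derive_funX f n x a : is_derive x 1 f a ->
  is_derive x 1 (fun y => f y ^+ n) (n%:R * f x ^+ n.-1 * a).
Proof.
by move=> fa; have := @is_deriveX _ _ f n x 1 a fa; rewrite exprfctE.
Qed.

Lemma is_derive_funV f x a : f x != 0 -> is_derive x 1 f a ->
  is_derive x 1 (fun y => (f y)^-1) (- (f x) ^- 2 * a).
Proof. by move=> fx fa; exact: is_deriveV. Qed.

Lemma is_derive_fun_expR f x a : is_derive x 1 f a ->
  is_derive x 1 (fun y => expR (f y)) (expR (f x) * a).
Proof. by move=> fa; apply: is_derive1_comp. Qed.

Lemma is_derive_fun_ln f x a : 0 < f x -> is_derive x 1 f a ->
  is_derive x 1 (fun y => ln (f y)) ((f x)^-1 * a).
Proof.
move=> fx fa; exact: (@is_derive1_comp R (@ln R) f _ _ _ (is_derive1_ln fx) fa).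
Qed.

End derivatives.

(** The rules above are stated on applied lambda terms, so that their
    conclusions can be matched against the syntax of a closed formula;
    [derive_fun] applies them recursively and leaves the equality between the
    computed derivative and the announced one as the last goal, after the side
    conditions of inverses and logarithms. *)
Ltac derive_rule :=
  first [ eassumption
        | eapply is_derive_fun_id
        | eapply is_derive_fun_cst
        | eapply is_derive_funD
        | eapply is_derive_funN
        | eapply is_derive_funX
        | eapply is_derive_funM
        | eapply is_derive_funV
        | eapply is_derive_fun_expR
        | eapply is_derive_fun_ln ].
Ltac derive_fun := eapply trigger_derive; [repeat derive_rule|].

(** * Consequences of the mean value theorem *)

Section mean_value.
Context {R : realType}.
Implicit Types (f g : R -> R) (x y a b c : R).

Lemma is_derive_continuous f x a : is_derive x 1 f a -> {for x, continuous f}.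
Proof.
by case=> df _; exact/differentiable_continuous/derivable1_diffP.
Qed.

Lemma mean_value f df a b : a < b ->
  (forall x, a <= x <= b -> is_derive x 1 f (df x)) ->
  exists2 c, a < c < b & f b - f a = df c * (b - a).
Proof.
move=> ab fdf.
have fd x : x \in `]a, b[ -> is_derive x 1 f (df x).
  by rewrite in_itv/= => /andP[/ltW ax /ltW xb]; apply: fdf; rewrite ax.
have fc : {within `[a, b], continuous f}.
  apply/continuous_in_subspaceT => x; rewrite inE/= in_itv/=.
  by move=> /fdf /is_derive_continuous.
by have [c + ->] := MVT ab fd fc; rewrite in_itv/=; exists c.
Qed.

Lemma gt0_derive_lt f df a b : a < b ->
  (forall x, a <= x <= b -> is_derive x 1 f (df x)) ->
  (forall x, a < x < b -> 0 < df x) -> f a < f b.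
Proof.
move=> ab fdf df0; have [c cab fE] := @mean_value f df a b ab fdf.
by rewrite -subr_gt0 fE mulr_gt0 ?df0// subr_gt0.
Qed.

(** Iterated, this lemma proves an inequality between exponential
    polynomials on the positive half-line: differentiate until the sign is
    visible, the intermediate derivatives all vanishing at 0. *)
Lemma gt0_derive_gt0 f df : f 0 = 0 ->
  (forall x, 0 <= x -> is_derive x 1 f (df x)) ->
  (forall x, 0 < x -> 0 < df x) -> forall x, 0 < x -> 0 < f x.
Proof.
move=> f0 fdf df0 x x0; rewrite -f0.
by apply: (@gt0_derive_lt f df) => // y /andP[? ?]; [exact: fdf|exact: df0].
Qed.

(** A limit along the progressions [x + n] suffices to identify a constant, so
    that uniqueness arguments below only need sequential limits, for which
    dominated convergence is available. *)
Lemma derive0_vanish f : (forall x, 0 < x -> is_derive x 1 f 0) ->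
  (forall x, 0 < x -> f (x + n%:R) @[n --> \oo] --> 0) ->
  forall x, 0 < x -> f x = 0.
Proof.
move=> df0 fcvg x x0.
have fE n : f (x + n%:R) = f x.
  case: n => [|n]; first by rewrite addr0.
  have xn : x < x + n.+1%:R by rewrite ltrDl.
  have [|c _] := @mean_value f (fun=> 0) x (x + n.+1%:R) xn.
    by move=> y /andP[xy _]; apply: df0; exact: lt_le_trans xy.
  by rewrite mul0r => /eqP; rewrite subr_eq0 => /eqP.
have := fcvg x x0; under eq_fun do rewrite fE.
by move=> /(cvg_lim (@norm_hausdorff _ _)) <-; rewrite lim_cst.
Qed.

Lemma le_inv_cvg_shift0 (f : R -> R) (C x : R) : 0 < x ->
  (forall y, 0 < y -> `|f y| <= C / y) -> f (x + n%:R) @[n --> \oo] --> 0.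
Proof.
move=> x0 fC; apply/norm_cvg0P; rewrite -cvg_shiftS/=.
have C0 : 0 <= C.
  by have := le_trans (normr_ge0 _) (fC 1 ltr01); rewrite divr1.
apply: (@squeeze_cvgr _ _ _ _ (cst 0) (fun n => C * harmonic n)).
- apply: nearW => n; rewrite normr_ge0/=.
  have xn : 0 < x + n.+1%:R by rewrite addr_gt0.
  apply: le_trans (fC _ xn) _; rewrite ler_wpM2l// lef_pV2 ?posrE//.
  by rewrite lerDr ltW.
- exact: cvg_cst.
- rewrite -[X in _ --> X](mulr0 C); apply: cvgMl_tmp.
  exact: cvg_harmonic.
Qed.

End mean_value.

(** * The fundamental theorem of calculus on the open half-line *)

Section half_line_FTC.
Context {R : realType}.
Implicit Types f F : R -> R.
Notation mu := (@lebesgue_measure R).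
Notation D := (`]0, +oo[%classic : set R).

(* The integrands may be singular at 0, so the half-line is exhausted by
   compact segments; [n.+2] rather than [n.+1] makes all of them nondegenerate. *)
Let E n : set R := `[n.+2%:R^-1, n.+2%:R].

Let E_lt n : n.+2%:R^-1 < n.+2%:R :> R.
Proof.
by rewrite (@lt_trans _ _ 1)// ?ltr1n// invf_lt1// ltr1n.
Qed.

Let E_gt0 n t : E n t -> 0 < t.
Proof. by rewrite /E/= in_itv/= => /andP[+ _]; apply: lt_le_trans. Qed.

Let E_ndecr : nondecreasing_seq E.
Proof.
move=> m n mn; apply/subsetPset => t; rewrite /E/= !in_itv/= => /andP[mt tm].
rewrite (le_trans _ mt) ?lef_pV2 ?posrE ?ler_nat//=.
by rewrite (le_trans tm)// ler_nat.
Qed.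

Let bigcup_E : \bigcup_n E n = D.
Proof.
apply/seteqP; split=> [t [n _ /E_gt0 t0]/=|t /=]; rewrite in_itv/= andbT// => t0.
exists (Num.bound (t + t^-1)) => //.
have tb : t + t^-1 < (Num.bound (t + t^-1)).+2%:R.
  rewrite (@lt_trans _ _ (Num.bound (t + t^-1))%:R) ?ltr_nat//.
  by rewrite archi_boundP// addr_ge0 ?invr_ge0 ?ltW.
have tV : 0 < t^-1 by rewrite invr_gt0.
rewrite /E/= in_itv/=; apply/andP; split; last lra.
by rewrite -[leRHS]invrK lef_pV2 ?posrE//; lra.
Qed.

Variables f F : R -> R.
Hypothesis fc : forall t : R, 0 < t -> {for t, continuous f}.
Hypothesis Ff : forall t : R, 0 < t -> is_derive t 1 F (f t).

Lemma gt0_continuous_measurable : measurable_fun D f.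
Proof.
apply: subspace_continuous_measurable_fun => //.
apply/continuous_in_subspaceT => t; rewrite inE/= in_itv/= andbT; exact: fc.
Qed.

Let integral_E n :
  (\int[mu]_(t in E n) (f t)%:E = (F n.+2%:R - F n.+2%:R^-1)%:E)%E.
Proof.
have Fc t : E n t -> {for t, continuous F}.
  by move=> /E_gt0 t0; exact: is_derive_continuous (Ff t t0).
have [lE rE] : E n n.+2%:R^-1 /\ E n n.+2%:R.
  by rewrite /E/= !in_itv/= !lexx ltW.
rewrite EFinB; apply: continuous_FTC2 => //.
- apply/continuous_in_subspaceT => t; rewrite inE => /E_gt0; exact: fc.
- split.
  + move=> t /subset_itv_oo_cc /E_gt0 t0; by have [] := Ff t t0.
  + exact: cvg_at_right_filter (Fc _ lE).
  + exact: cvg_at_left_filter (Fc _ rE).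
- move=> t /subset_itv_oo_cc /E_gt0 t0.
  by rewrite derive1E; have [_ ->] := Ff t t0.
Qed.

(** By monotone convergence, the integral of [f] is the supremum of the
    increments of [F], which are at most [2 * C]. *)
Lemma bounded_primitive_integrable (C : R) :
  (forall t : R, 0 < t -> 0 <= f t) -> (forall t : R, 0 < t -> `|F t| <= C) ->
  mu.-integrable D (EFin \o f).
Proof.
move=> f0 FC; have mf := gt0_continuous_measurable.
apply/integrableP; split; first exact/measurable_EFinP.
have -> : (\int[mu]_(t in D) `|(EFin \o f) t| = \int[mu]_(t in D) (f t)%:E)%E.
  apply: eq_integral => t; rewrite inE/= in_itv/= andbT => t0.
  by rewrite ger0_norm// f0.
rewrite -bigcup_E.
have cvgE : (\int[mu]_(t in E n) (f t)%:E @[n --> \oo] -->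
    \int[mu]_(t in \bigcup_n E n) (f t)%:E)%E.
  apply: ge0_nondecreasing_set_cvg_integral => //.
  - by move=> n; rewrite /E.
  - move=> n; apply/measurable_EFinP; apply: measurable_funS mf => //.
    by rewrite -bigcup_E; exact: bigcup_sup.
  - by move=> n t /E_gt0 t0; rewrite lee_fin f0.
have /le_lt_trans : (\int[mu]_(t in \bigcup_n E n) (f t)%:E <= (C + C)%:E)%E.
  rewrite -(cvg_lim _ cvgE)//; apply: lime_le.
    by apply/cvg_ex; eexists; exact: cvgE.
  apply: nearW => n; rewrite integral_E lee_fin.
  have := FC n.+2%:R; have := FC n.+2%:R^-1.
  rewrite invr_gt0 ltr0n => /(_ isT) /ler_normlP[? ?] /(_ isT) /ler_normlP[? ?].
  lra.
by apply; rewrite ltry.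
Qed.

(** No sign condition is imposed on [f]: integrability provides the dominating
    function. *)
Lemma Rintegral_primitive (a l : R) :
  mu.-integrable D (EFin \o f) -> F t @[t --> 0^'+] --> a ->
  F t @[t --> +oo] --> l -> \int[mu]_(t in D) f t = l - a.
Proof.
move=> fi Fa Fl; have mf := gt0_continuous_measurable.
have EsubD n : E n `<=` D by rewrite -bigcup_E; exact: bigcup_sup.
have cvgE : (\int[mu]_(t in D) ((f \_ (E n)) t)%:E @[n --> \oo] -->
    \int[mu]_(t in D) (f t)%:E)%E.
  apply: (@dominated_cvg _ _ _ mu D _ _ _ (fun t => `|f t|%:E)) => //.
  - move=> n; apply/measurable_EFinP/measurable_restrict => //.
      by rewrite /E.
    by rewrite setIidr//; apply: measurable_funS mf.
  - move=> t; rewrite -bigcup_E => -[n _ En]; apply: cvg_near_cst.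
    near=> m; rewrite patchE mem_set//.
    have /subsetPset : (E n <= E m)%O.
      by apply: E_ndecr; near: m; exact: nbhs_infty_ge.
    exact.
  - exact: integrable_norm.
  - move=> n t _; rewrite lee_fin patchE; case: ifP => // _.
    by rewrite normr0.
have FE : (F n.+2%:R - F n.+2%:R^-1) @[n --> \oo] --> l - a.
  have n2 : n.+2%:R @[n --> \oo] --> (+oo : set_system R).
    have := @cvgr_idn R; rewrite -(cvg_shiftn 2).
    by under eq_fun do rewrite addn2.
  apply: cvgB.
    exact: cvg_comp n2 Fl.
  move/cvg_at_rightP: Fa; apply; split=> [n|]; first by rewrite invr_gt0.
  by have := @cvg_harmonic R; rewrite -cvg_shiftS.
have intE n : (\int[mu]_(t in D) ((f \_ (E n)) t)%:E =
    (F n.+2%:R - F n.+2%:R^-1)%:E)%E.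
  rewrite -integral_E -[in RHS](setIidr (@EsubD n)) integral_mkcondr.
  by apply: eq_integral => t _; rewrite restrict_EFin.
apply: EFin_inj; rewrite /Rintegral fineK; last exact: integrable_fin_num.
apply: (cvg_unique _ cvgE) => //.
rewrite (funext intE).
by apply/cvg_EFin; [exact: nearW|exact: FE].
Unshelve. all: end_near. Qed.

End half_line_FTC.

(** * Laplace transforms *)

Section laplace.
Context {R : realType}.
Implicit Types (f g : R -> R) (x y t : R).
Notation mu := (@lebesgue_measure R).
Notation D := (`]0, +oo[%classic : set R).

Let mD : measurable (D : set (measurableTypeR R)).
Proof. exact: measurable_itv. Qed.

Definition laplace f x : R := \int[mu]_(t in D) (f t * expR (- (x * t))).

(** Integrability is required at every positive point: this makes the class
    stable under multiplication by the variable, hence its Laplace transforms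
    infinitely differentiable. *)
Definition laplaceable f := measurable_fun D f /\
  forall x, 0 < x ->
    mu.-integrable D (EFin \o (fun t => f t * expR (- (x * t)))).

Lemma itv0y_gt0 t : D t -> 0 < t.
Proof. by rewrite /= in_itv/= andbT. Qed.

Lemma expRNM_continuous (x t : R) :
  {for t, continuous (fun t => expR (- (x * t)))}.
Proof.
have d : is_derive t 1 (fun t => expR (- (x * t))) (- x * expR (- (x * t))).
  by derive_fun; rewrite /=; ring.
exact: is_derive_continuous d.
Qed.

Lemma expRNM_cvgy (x : R) : 0 < x -> expR (- (x * t)) @[t --> +oo] --> (0 : R).
Proof.
move=> x0.
apply: (@cvg_comp _ _ _ (fun t => x * t) (fun z => expR (- z)) _ +oo).
  exact: gt0_cvgMry.
exact: cvgr_expR.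
Qed.

Lemma expRNM_cvg0 (x : R) : expR (- (x * t)) @[t --> 0^'+] --> (1 : R).
Proof.
apply: cvg_at_right_filter; have := expRNM_continuous x 0.
by rewrite /prop_for /continuous_at mulr0 oppr0 expR0.
Qed.

Lemma measurable_expRNM (x : R) : measurable_fun D (fun t => expR (- (x * t))).
Proof.
apply: measurable_funTS; apply: continuous_measurable_fun => t.
exact: expRNM_continuous.
Qed.

Lemma integrable_exp_le f g x y : measurable_fun D f ->
  (forall t, 0 < t -> `|f t * expR (- (x * t))| <= `|g t * expR (- (y * t))|) ->
  mu.-integrable D (EFin \o (fun t => g t * expR (- (y * t)))) ->
  mu.-integrable D (EFin \o (fun t => f t * expR (- (x * t)))).
Proof.
move=> mf fg; apply: le_integrable => //.
  apply/measurable_EFinP; apply: measurable_funM => //.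
  exact: measurable_expRNM.
by move=> t /itv0y_gt0 t0; rewrite lee_fin fg.
Qed.

Lemma laplaceable_le f g : measurable_fun D f ->
  (forall t, 0 < t -> `|f t| <= `|g t|) -> laplaceable g -> laplaceable f.
Proof.
move=> mf fg [mg ig]; split=> // x x0.
apply: (@integrable_exp_le f g x x) => // [t t0|]; last exact: ig.
by rewrite !normrM ler_wpM2r// fg.
Qed.

Lemma eq_laplaceable f g : (forall t, 0 < t -> f t = g t) ->
  laplaceable f -> laplaceable g.
Proof.
move=> fg lf.
apply: (@laplaceable_le g f _ _ lf) => [|t t0]; last by rewrite fg.
have [mf _] := lf.
by apply: eq_measurable_fun mf => t; rewrite inE => /itv0y_gt0 /fg.
Qed.

Lemma eq_laplace f g x : (forall t, 0 < t -> f t = g t) ->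
  laplace f x = laplace g x.
Proof.
by move=> fg; apply: eq_Rintegral => t; rewrite inE => /itv0y_gt0 /fg ->.
Qed.

Lemma laplaceableZ (k : R) f : laplaceable f -> laplaceable (fun t => k * f t).
Proof.
move=> [mf lf]; split=> [|x x0]; first exact: measurable_funM.
have := integrableZl mD k (lf x x0).
by apply: eq_integrable => // t _; rewrite /= -EFinM mulrA.
Qed.

Lemma laplaceableD f g : laplaceable f -> laplaceable g ->
  laplaceable (fun t => f t + g t).
Proof.
move=> [mf lf] [mg lg]; split=> [|x x0]; first exact: measurable_funD.
have := integrableD mD (lf x x0) (lg x x0).
by apply: eq_integrable => // t _; rewrite /= -EFinD mulrDl.
Qed.

Lemma laplaceZ (k : R) f x : laplaceable f -> 0 < x ->
  laplace (fun t => k * f t) x = k * laplace f x.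
Proof.
move=> [mf lf] x0; rewrite /laplace -RintegralZl//; last exact: lf.
by apply: eq_Rintegral => t _; rewrite mulrA.
Qed.

Lemma laplaceD f g x : laplaceable f -> laplaceable g -> 0 < x ->
  laplace (fun t => f t + g t) x = laplace f x + laplace g x.
Proof.
move=> [mf lf] [mg lg] x0.
rewrite /laplace -RintegralD//; [|exact: lf|exact: lg].
by apply: eq_Rintegral => t _; rewrite mulrDl.
Qed.

(** Half of the exponential absorbs the factor [t]:
    [t * exp (- x t / 2) <= 2 / x]. *)
Lemma laplaceable_mulid f : laplaceable f -> laplaceable (fun t => t * f t).
Proof.
move=> [mf lf]; have mtf : measurable_fun D (fun t => t * f t).
  by apply: measurable_funM => //; exact: measurable_id.
split=> // x x0; have x20 : 0 < x / 2 by rewrite divr_gt0.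
apply: (@integrable_exp_le _ (fun t => 2 / x * f t) x (x / 2)) => // [t t0|].
  rewrite !normrM !(ger0_norm (expR_ge0 _)) (gtr0_norm t0).
  rewrite [`|2|]gtr0_norm// [`|x^-1|]gtr0_norm ?invr_gt0//.
  rewrite [t * _]mulrC [2 / x * _]mulrC -2!(mulrA `|f t|) ler_wpM2l//.
  have -> : - (x * t) = - (x / 2 * t) - x / 2 * t by field.
  rewrite expRD mulrCA mulrC ler_wpM2r ?expR_ge0//.
  rewrite expRN ler_pdivrMr ?expR_gt0//.
  have h := expR_ge1Dx (x / 2 * t).
  have {1}-> : t = 2 / x * (x / 2 * t) by field; rewrite gt_eqF.
  by rewrite ler_wpM2l ?divr_ge0 ?(ltW x0)//; lra.
by have [_] := @laplaceableZ (2 / x) f (conj mf lf); apply.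
Qed.

(** On the neighbourhood [`]x / 2, x + 1[] of [x] the derivative of the
    integrand is dominated by its value at [x / 2], which is integrable because
    multiplication by the variable preserves [laplaceable]. *)
Lemma laplace_derive f x : laplaceable f -> 0 < x ->
  is_derive x 1 (laplace f) (- laplace (fun t => t * f t) x).
Proof.
move=> lf x0; have [mtf ltf] := laplaceable_mulid _ lf; have [mf iif] := lf.
pose k y t := f t * expR (- (y * t)).
have dk y t : is_derive y 1 (k ^~ t) (- (t * f t) * expR (- (y * t))).
  by rewrite /k; derive_fun; rewrite /=; ring.
have dkE y t : partial1of2 k y t = - (t * f t) * expR (- (y * t)).
  by rewrite partial1of2E; have [_ ->] := dk y t.
have x2 : 0 < x / 2 by rewrite divr_gt0.
have Ix : [set` `]x / 2, x + 1[] x.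
  by rewrite /= in_itv/=; apply/andP; split; lra.
have I0 y : [set` `]x / 2, x + 1[] y -> x / 2 < y.
  by rewrite /= in_itv/= => /andP[].
pose G t := `|t * f t * expR (- (x / 2 * t))|.
have intk y : [set` `]x / 2, x + 1[] y -> mu.-integrable D (EFin \o k y).
  by move=> /I0 yx; apply: iif; exact: lt_trans yx.
have derk y t : [set` `]x / 2, x + 1[] y -> D t -> derivable (k ^~ t) y 1.
  by move=> _ _; have [] := dk y t.
have G0 t : 0 <= G t by exact: normr_ge0.
have iG : mu.-integrable D (EFin \o G).
  by apply: integrable_norm => //; exact: ltf.
have Gub y t : [set` `]x / 2, x + 1[] y -> D t -> `|partial1of2 k y t| <= G t.
  move=> /I0 yx /itv0y_gt0 t0; rewrite dkE mulNr normrN /G !normrM ler_wpM2l//.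
  by rewrite !(ger0_norm (expR_ge0 _)) ler_expR lerN2 ler_wpM2r ?ltW.
apply: DeriveDef.
  exact: (derivable_under_integral mD Ix intk derk G0 iG Gub).
rewrite -derive1E.
rewrite (differentiation_under_integral mD Ix intk derk G0 iG Gub).
rewrite -[RHS]mulN1r -RintegralZl//; last exact: ltf.
by apply: eq_Rintegral => t _; rewrite dkE mulN1r mulNr.
Qed.

Lemma laplace_shift_cvg0 f x : laplaceable f -> 0 < x ->
  laplace f (x + n%:R) @[n --> \oo] --> 0.
Proof.
move=> [mf lf] x0.
have xn0 n : 0 < x + n%:R by rewrite ltr_wpDr.
rewrite /laplace/Rintegral.
apply: fine_cvg.
have -> : (0%:E = \int[mu]_(t in D) (cst 0%E t) :> \bar R)%E.
  by rewrite integral0.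
apply: (@dominated_cvg _ _ _ mu D _ _ _
  (fun t => `|f t * expR (- (x * t))|%:E)) => //.
- by move=> n; apply: (measurable_int mu); exact: lf.
- move=> t /itv0y_gt0 t0; apply/cvg_EFin; first exact: nearW.
  rewrite -[X in _ --> X](mulr0 (f t)); apply: cvgM; first exact: cvg_cst.
  apply: (@le_inv_cvg_shift0 _ (fun y => expR (- (y * t))) t^-1 x x0) => y y0.
  rewrite ger0_norm ?expR_ge0// expRN -invfM.
  rewrite lef_pV2 ?posrE ?expR_gt0 ?mulr_gt0//.
  by have := expR_ge1Dx (y * t); rewrite mulrC; lra.
- by apply: integrable_norm; exact: lf.
- move=> n t /itv0y_gt0 t0; rewrite lee_fin !normrM ler_wpM2l//.
  rewrite !(ger0_norm (expR_ge0 _)) ler_expR lerN2.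
  by rewrite ler_wpM2r ?(ltW t0) ?lerDl.
Qed.

(** A nonnegative function of integral 0 vanishes almost everywhere, whereas
    the half-line has infinite measure. *)
Lemma Rintegral_gt0 f : mu.-integrable D (EFin \o f) ->
  (forall t, 0 < t -> 0 < f t) -> 0 < \int[mu]_(t in D) f t.
Proof.
move=> fi f0; have mf := measurable_int mu fi.
rewrite lt_neqAle Rintegral_ge0 ?andbT; last by move=> t /itv0y_gt0 /f0 /ltW.
apply/eqP => I0.
have : (\int[mu]_(t in D) `|(EFin \o f) t| = 0)%E.
  transitivity ((\int[mu]_(t in D) f t)%:E); last by rewrite -I0.
  rewrite /Rintegral fineK; last exact: integrable_fin_num.
  apply: eq_integral => t; rewrite inE => /itv0y_gt0 /f0 /ltW.
  by move=> /ger0_norm /= ->.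
move/(ae_eq_integral_abs mu mD mf) => [N [mN N0 DN]].
have : (mu D <= mu N)%E.
  apply: le_measure; rewrite ?inE// => t Dt; apply: DN => /= /(_ Dt) [ft0].
  by have := f0 t (itv0y_gt0 t Dt); rewrite ft0 ltxx.
by rewrite N0 lebesgue_measure_itv/= ltry.
Qed.

Lemma laplace_gt0 f x : laplaceable f -> (forall t, 0 < t -> 0 < f t) ->
  0 < x -> 0 < laplace f x.
Proof.
move=> [_ lf] f0 x0; apply: Rintegral_gt0 (lf x x0) _ => t t0.
by rewrite mulr_gt0 ?expR_gt0 ?f0.
Qed.

End laplace.

(** * The kernel of Binet's integral *)

Section binet_kernel.
Context {R : realType}.
Implicit Types t : R.

(** Up to a positive denominator, this is minus the derivative of Binet's
    kernel. It vanishes at 0 together with its first derivative, and its second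
    derivative is [expR s] times a function which vanishes at 0 together with
    its first two derivatives and has third derivative [4 * s * expR s]. *)
Lemma dbinet_kernel_num_gt0 t : 0 < t ->
  0 < (t - 4) * expR t ^+ 2 + (2 * t ^+ 2 + 8) * expR t - t - 4.
Proof.
have V2 : forall s : R, 0 < s -> 0 < (4 * s - 4) * expR s + 4.
  apply: (@gt0_derive_gt0 R _ (fun s => 4 * s * expR s)).
  - by rewrite expR0; lra.
  - by move=> s _; derive_fun; rewrite /=; ring.
  - by move=> s s0; rewrite !mulr_gt0 ?expR_gt0.
have V1 : forall s : R, 0 < s -> 0 < (4 * s - 8) * expR s + (4 * s + 8).
  apply: (@gt0_derive_gt0 R _ (fun s => (4 * s - 4) * expR s + 4)) => //.
  - by rewrite expR0; lra.
  - by move=> s _; derive_fun; rewrite /=; ring.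
have V0 : forall s : R, 0 < s ->
    0 < (4 * s - 12) * expR s + (2 * s ^+ 2 + 8 * s + 12).
  apply: (@gt0_derive_gt0 R _
    (fun s => (4 * s - 8) * expR s + (4 * s + 8))) => //.
  - by rewrite expR0; lra.
  - by move=> s _; derive_fun; rewrite /=; ring.
have W1 : forall s : R, 0 < s ->
    0 < (2 * s - 7) * expR s ^+ 2 + (2 * s ^+ 2 + 4 * s + 8) * expR s - 1.
  apply: (@gt0_derive_gt0 R _ (fun s =>
    expR s * ((4 * s - 12) * expR s + (2 * s ^+ 2 + 8 * s + 12)))) => //.
  - by rewrite expR0; lra.
  - by move=> s _; derive_fun; rewrite /=; ring.
  - by move=> s s0; rewrite mulr_gt0 ?expR_gt0 ?V0.
move: t; apply: (@gt0_derive_gt0 R _ (fun s =>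
    (2 * s - 7) * expR s ^+ 2 + (2 * s ^+ 2 + 4 * s + 8) * expR s - 1)) => //.
- by rewrite expR0; lra.
- by move=> s _; derive_fun; rewrite /=; ring.
Qed.

(** The kernel of Binet's first formula for the logarithm of the Gamma
    function. It extends analytically to 0, with value [1 / 12]. *)
Definition binet_kernel t := ((expR t - 1)^-1 - t^-1 + 2^-1) / t.

Definition dbinet_kernel t :=
  - ((t - 4) * expR t ^+ 2 + (2 * t ^+ 2 + 8) * expR t - t - 4) /
    (2 * t ^+ 3 * (expR t - 1) ^+ 2).

Lemma expRB1_gt0 t : 0 < t -> 0 < expR t - 1.
Proof. by move=> t0; rewrite subr_gt0 expR_gt1. Qed.

Lemma is_derive_binet_kernel t : 0 < t ->
  is_derive t 1 binet_kernel (dbinet_kernel t).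
Proof.
move=> t0; have e0 := expRB1_gt0 t t0.
rewrite /binet_kernel /dbinet_kernel; derive_fun; rewrite /=.
- by rewrite gt_eqF.
- by rewrite gt_eqF.
- by rewrite gt_eqF.
- by field; rewrite !gt_eqF.
Qed.

Lemma dbinet_kernel_lt0 t : 0 < t -> dbinet_kernel t < 0.
Proof.
move=> t0; rewrite /dbinet_kernel mulNr oppr_lt0.
rewrite divr_gt0 ?dbinet_kernel_num_gt0//.
by rewrite !mulr_gt0 ?exprn_gt0 ?expRB1_gt0.
Qed.

Lemma dbinet_kernel_continuous t : 0 < t -> {for t, continuous dbinet_kernel}.
Proof.
move=> t0; have e0 := expRB1_gt0 t t0.
have d : {d | is_derive t 1 dbinet_kernel d}.
  eexists; rewrite /dbinet_kernel; repeat derive_rule; rewrite /=.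
  by rewrite gt_eqF// !mulr_gt0 ?exprn_gt0.
by case: d => d /is_derive_continuous.
Qed.

Let numE t : 0 < t -> binet_kernel t =
  ((t - 2) * expR t + t + 2) / (2 * t ^+ 2 * (expR t - 1)).
Proof.
move=> t0; rewrite /binet_kernel; field.
by rewrite !gt_eqF ?expRB1_gt0.
Qed.

(** Clearing denominators, the difference of both sides becomes
    [(s ^+ 2 - 6 * s + 12) * expR s - s ^+ 2 - 6 * s - 12], which vanishes at 0
    together with its first two derivatives and has third derivative
    [s ^+ 2 * expR s]. *)
Lemma binet_kernel_le t : 0 < t -> binet_kernel t <= 12^-1.
Proof.
move=> t0; rewrite numE// ler_pdivrMr ?mulr_gt0 ?exprn_gt0 ?expRB1_gt0//.
have D2 : forall s : R, 0 < s -> 0 < (s ^+ 2 - 2 * s + 2) * expR s - 2.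
  apply: (@gt0_derive_gt0 R _ (fun s => s ^+ 2 * expR s)).
  - by rewrite expR0; lra.
  - by move=> s _; derive_fun; rewrite /=; ring.
  - by move=> s s0; rewrite !mulr_gt0 ?expR_gt0.
have D1 : forall s : R, 0 < s ->
    0 < (s ^+ 2 - 4 * s + 6) * expR s - 2 * s - 6.
  apply: (@gt0_derive_gt0 R _
    (fun s => (s ^+ 2 - 2 * s + 2) * expR s - 2)) => //.
  - by rewrite expR0; lra.
  - by move=> s _; derive_fun; rewrite /=; ring.
have : forall s : R, 0 < s ->
    0 < (s ^+ 2 - 6 * s + 12) * expR s - s ^+ 2 - 6 * s - 12.
  apply: (@gt0_derive_gt0 R _
    (fun s => (s ^+ 2 - 4 * s + 6) * expR s - 2 * s - 6)) => //.
  - by rewrite expR0; lra.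
  - by move=> s _; derive_fun; rewrite /=; ring.
move=> /(_ t t0); lra.
Qed.

(** A crude companion of the upper bound, with the same limit at 0; it yields
    both the positivity of the kernel and its value at 0. *)
Lemma binet_kernel_ge t : 0 < t -> expR (- t) / 12 <= binet_kernel t.
Proof.
move=> t0; have e0 := expRB1_gt0 t t0.
rewrite numE// ler_pdivlMr ?mulr_gt0 ?exprn_gt0//.
have D1 : forall s : R, 0 < s -> 0 < 6 * (s - 1) * expR s + 6 - 3 * s ^+ 2.
  apply: (@gt0_derive_gt0 R _ (fun s => 6 * s * (expR s - 1))).
  - by rewrite expR0; lra.
  - by move=> s _; derive_fun; rewrite /=; ring.
  - by move=> s s0; rewrite !mulr_gt0 ?expRB1_gt0.
have D0 : forall s : R, 0 < s -> 0 < 6 * ((s - 2) * expR s + s + 2) - s ^+ 3.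
  apply: (@gt0_derive_gt0 R _
    (fun s => 6 * (s - 1) * expR s + 6 - 3 * s ^+ 2)) => //.
  - by rewrite expR0; lra.
  - by move=> s _; derive_fun; rewrite /=; ring.
have h : expR (- t) * (expR t - 1) <= t.
  rewrite mulrBr mulr1 [_ * expR t]mulrC expRxMexpNx_1.
  by have := expR_ge1Dx (- t); lra.
have := D0 t t0.
have : t ^+ 2 * (expR (- t) * (expR t - 1)) <= t ^+ 2 * t.
  by rewrite ler_wpM2l ?sqr_ge0.
lra.
Qed.

Lemma binet_kernel_gt0 t : 0 < t -> 0 < binet_kernel t.
Proof.
move=> t0; apply: lt_le_trans (binet_kernel_ge t t0).
by rewrite divr_gt0 ?expR_gt0.
Qed.

Lemma binet_kernel_cvg0 : binet_kernel t @[t --> 0^'+] --> (12^-1 : R).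
Proof.
apply: (@squeeze_cvgr _ _ _ _ (fun t => expR (- t) / 12) (fun=> 12^-1)).
- near=> t; rewrite binet_kernel_ge ?binet_kernel_le//=;
    near: t; exact: nbhs_right_gt.
- apply: cvg_at_right_filter.
  have d : is_derive (0 : R) 1 (fun t => expR (- t) / 12) (- 12^-1).
    by derive_fun; rewrite /= oppr0 expR0; lra.
  have := is_derive_continuous _ _ _ d.
  by rewrite /prop_for /continuous_at oppr0 expR0 mul1r.
- exact: cvg_cst.
Unshelve. all: end_near. Qed.

End binet_kernel.

(** * The Laplace transform of Binet's kernel *)

Section binet_integral.
Context {R : realType}.
Implicit Types (f : R -> R) (t x y : R).
Notation mu := (@lebesgue_measure R).
Notation D := (`]0, +oo[%classic : set R).

Lemma eq_gt0_is_derive (f g : R -> R) x a : 0 < x ->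
  (forall y, 0 < y -> f y = g y) -> is_derive x 1 f a -> is_derive x 1 g a.
Proof.
move=> x0 fg; apply: near_eq_is_derive; near=> y; apply: fg.
by near: y; exact: lt_nbhsr.
Unshelve. all: end_near. Qed.

Let cst1_primitive (x t : R) : 0 < x ->
  is_derive t 1 (fun t => - expR (- (x * t)) / x) (1 * expR (- (x * t))).
Proof.
by move=> x0; derive_fun; rewrite /=; field; rewrite gt_eqF.
Qed.

Lemma laplaceable1 : laplaceable (fun=> 1 : R).
Proof.
split=> // x x0.
apply: (@bounded_primitive_integrable R _
  (fun t => - expR (- (x * t)) / x) _ _ x^-1).
- move=> t _; rewrite (_ : (fun _ => _) = fun t => expR (- (x * t))).
    exact: expRNM_continuous.
  by apply/funext => s; rewrite mul1r.
- by move=> t _; exact: cst1_primitive.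
- by move=> t _; rewrite mul1r expR_ge0.
- move=> t t0; rewrite mulNr normrN normrM !gtr0_norm ?expR_gt0 ?invr_gt0//.
  by rewrite ler_piMl ?invr_ge0 ?ltW// -expR0 ltr_expR oppr_lt0 mulr_gt0.
Qed.

Lemma laplace1 x : 0 < x -> laplace (fun=> 1) x = x^-1.
Proof.
move=> x0; rewrite /laplace.
rewrite (@Rintegral_primitive R _
  (fun t => - expR (- (x * t)) / x) _ _ (- x^-1) 0).
- by rewrite sub0r opprK.
- move=> t _; rewrite (_ : (fun _ => _) = fun t => expR (- (x * t))).
    exact: expRNM_continuous.
  by apply/funext => s; rewrite mul1r.
- by move=> t _; exact: cst1_primitive.
- by have [_] := laplaceable1; exact.
- rewrite -[X in _ --> - X]mul1r -mulNr; apply: cvgMr_tmp; apply: cvgN.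
  exact: expRNM_cvg0.
- rewrite -(mul0r x^-1) -oppr0; apply: cvgMr_tmp; apply: cvgN.
  exact: expRNM_cvgy.
Qed.

Lemma laplaceable_id : laplaceable (fun t : R => t).
Proof.
apply: eq_laplaceable (laplaceable_mulid _ laplaceable1) => t _.
by rewrite mulr1.
Qed.

(** This is minus the derivative of [laplace (fun=> 1)], that is of [x^-1]. *)
Lemma laplace_id x : 0 < x -> laplace (fun t => t) x = x ^- 2.
Proof.
move=> x0; have [_ d1] := laplace_derive _ x laplaceable1 x0.
have [_ d2] : is_derive x 1 (laplace (fun=> 1 : R)) (- x ^- 2).
  apply: (@eq_gt0_is_derive (fun y => y^-1)) => // [y y0|].
    by rewrite laplace1.
  by derive_fun; rewrite ?gt_eqF//= mulr1.
rewrite -[RHS]opprK -d2 d1 opprK.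
by apply: eq_laplace => t _; rewrite mulr1.
Qed.

Lemma laplace_shift f x :
  laplace f (x + 1) = laplace (fun t => expR (- t) * f t) x.
Proof.
apply: eq_Rintegral => t _.
by rewrite mulrDl mul1r opprD expRD; ring.
Qed.

Lemma laplaceable_expN f : laplaceable f ->
  laplaceable (fun t => expR (- t) * f t).
Proof.
move=> lf; apply: (laplaceable_le _ _ _ _ lf) => [|t t0].
  apply: measurable_funM; last by have [] := lf.
  rewrite (_ : (fun t => _) = fun t => expR (- (1 * t))).
    exact: measurable_expRNM.
  by apply/funext => t; rewrite mul1r.
rewrite normrM ler_piMl// ger0_norm ?expR_ge0// -expR0 ler_expR.
by rewrite oppr_le0 ltW.
Qed.

Lemma laplaceable_binet_kernel : laplaceable (@binet_kernel R).
Proof.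
apply: (laplaceable_le _ _ _ _ (laplaceableZ 12^-1 _ laplaceable1)) => [|t t0].
  apply: gt0_continuous_measurable => t t0.
  exact: is_derive_continuous (is_derive_binet_kernel t t0).
rewrite mulr1 !ger0_norm// ?binet_kernel_le//.
by rewrite ltW ?binet_kernel_gt0.
Qed.

(* Since the kernel is positive and decreasing, the derivative [f] of [F] is
   nonnegative. Its integrability, and with it that of the integrand of the
   transform of [dbinet_kernel], thus follows from the boundedness of [F]. *)
Section integration_by_parts.
Variables (x : R) (x0 : 0 < x).

Let F t := - (binet_kernel t * expR (- (x * t))).
Let f t := (x * binet_kernel t - dbinet_kernel t) * expR (- (x * t)).

Let fc (t : R) : 0 < t -> {for t, continuous f}.
Proof.
move=> t0; rewrite /f; apply: cvgM; last exact: expRNM_continuous.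
apply: cvgB; last exact: dbinet_kernel_continuous.
apply: cvgM; first exact: cvg_cst.
exact: is_derive_continuous (is_derive_binet_kernel t t0).
Qed.

Let Ff (t : R) : 0 < t -> is_derive t 1 F (f t).
Proof.
move=> t0; have dk := is_derive_binet_kernel t t0.
by rewrite /F /f; derive_fun; rewrite /=; ring.
Qed.

Let F_le (t : R) : 0 < t -> `|F t| <= 12^-1 * expR (- (x * t)).
Proof.
move=> t0; rewrite normrN normrM !gtr0_norm ?expR_gt0 ?binet_kernel_gt0//.
by rewrite ler_wpM2r ?expR_ge0 ?binet_kernel_le.
Qed.

Let f_integrable : mu.-integrable D (EFin \o f).
Proof.
apply: (bounded_primitive_integrable f F fc Ff 12^-1) => t t0.
  have k0 := binet_kernel_gt0 t t0; have dk0 := dbinet_kernel_lt0 t t0.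
  rewrite /f mulr_ge0 ?expR_ge0// subr_ge0 (le_trans (ltW dk0))//.
  by rewrite ltW// mulr_gt0.
apply: le_trans (F_le _ t0) _.
by rewrite ler_piMr// -expR0 ler_expR oppr_le0 mulr_ge0 ?ltW.
Qed.

Let f_integral : \int[mu]_(t in D) f t = 12^-1.
Proof.
rewrite (Rintegral_primitive f F fc Ff (- 12^-1) 0) ?sub0r ?opprK//.
  rewrite /F -[X in _ --> - X]mulr1; apply: cvgN; apply: cvgM.
    exact: binet_kernel_cvg0.
  exact: expRNM_cvg0.
apply/norm_cvg0P.
apply: (@squeeze_cvgr _ _ _ _ (cst 0) (fun t => 12^-1 * expR (- (x * t)))).
- near=> t; rewrite normr_ge0 F_le//; near: t; exact: nbhs_pinfty_gt.
- exact: cvg_cst.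
- rewrite -[X in _ --> X](mulr0 12^-1); apply: cvgMl_tmp; exact: expRNM_cvgy.
Unshelve. all: end_near. Qed.

Lemma integrable_dbinet_kernel :
  mu.-integrable D (EFin \o (fun t => dbinet_kernel t * expR (- (x * t)))).
Proof.
have [_ lk] := laplaceable_binet_kernel.
have mD : measurable (D : set (measurableTypeR R)) by exact: measurable_itv.
have := integrableB mD (integrableZl mD x (lk x x0)) f_integrable.
apply: eq_integrable => // t _; rewrite /= -EFinM -EFinB /f.
by congr EFin; ring.
Qed.

(** Integration by parts; [12^-1] is the value of the kernel at 0. *)
Lemma laplace_binet_kernel_parts :
  x * laplace binet_kernel x = 12^-1 + laplace dbinet_kernel x.
Proof.
have [_ lk] := laplaceable_binet_kernel.
rewrite -f_integral /laplace -RintegralZl//; last exact: lk.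
rewrite -RintegralD//; last exact: integrable_dbinet_kernel.
by apply: eq_Rintegral => t _; rewrite /f; ring.
Qed.

End integration_by_parts.

Lemma laplaceable_dbinet_kernel : laplaceable (@dbinet_kernel R).
Proof.
split; last exact: integrable_dbinet_kernel.
by apply: gt0_continuous_measurable => t t0; exact: dbinet_kernel_continuous.
Qed.

Lemma lnD1_bounds y : 0 < y -> (y + 1)^-1 <= ln (y + 1) - ln y <= y^-1.
Proof.
move=> y0; have y1 : 0 < y + 1 by rewrite addr_gt0.
apply/andP; split.
  rewrite -lerN2 opprB -ln_div ?posrE//.
  have -> : y / (y + 1) = 1 + - (y + 1)^-1 by field; rewrite gt_eqF.
  by apply: le_ln1Dx; rewrite ltrN2 invf_lt1// ltrDr.
rewrite -ln_div ?posrE//.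
have -> : (y + 1) / y = 1 + y^-1 by field; rewrite gt_eqF.
by apply: le_ln1Dx; rewrite (@lt_trans _ _ 0) ?invr_gt0 ?oppr_lt0.
Qed.

(** The general term of Gudermann's series for the remainder in Stirling's
    formula. *)
Definition gudermann (x : R) : R := (x + 2^-1) * (ln (x + 1) - ln x) - 1.

(** Differentiating twice replaces the kernel by [t ^+ 2] times itself; the
    product of the latter with [1 - expR (- t)] is a combination of 1, [t] and
    their products with [expR (- t)], so that both sides have the same, rational,
    second derivative. Both sides and their first derivatives tend to 0 along
    [x + n], which makes the two constants of integration vanish. *)
Lemma laplace_binet_kernelB x : 0 < x ->
  laplace binet_kernel x - laplace binet_kernel (x + 1) = gudermann x.
Proof.
pose k1 := fun t : R => t * binet_kernel t.
pose k2 := fun t : R => t * k1 t.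
have lk1 : laplaceable k1 by exact: laplaceable_mulid laplaceable_binet_kernel.
have lk2 : laplaceable k2 by exact: laplaceable_mulid lk1.
pose G1 (y : R) := ln (y + 1) - ln y - 2^-1 / y - 2^-1 / (y + 1).
have Sgt0 (y : R) : 0 < y -> 0 < y + 1 by move=> y0; rewrite addr_gt0.
have dA f y : laplaceable f -> 0 < y ->
    is_derive y 1 (fun y => laplace f y - laplace f (y + 1))
      (- laplace (fun t => t * f t) y + laplace (fun t => t * f t) (y + 1)).
  move=> lf y0; rewrite -[X in _ + X]opprK.
  apply: is_derive_funD; first exact: laplace_derive.
  apply: is_derive_funN.
  have d1 : is_derive y 1 (fun y => y + 1) (1 : R) by derive_fun; rewrite addr0.
  have := @is_derive1_comp R (laplace f) (fun y => y + 1) y _ _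
    (laplace_derive f (y + 1) lf (Sgt0 y y0)) d1.
  by rewrite mulr1.
have k2E y : 0 < y -> laplace k2 y - laplace k2 (y + 1) =
    2^-1 / y ^+ 2 + 2^-1 / (y + 1) ^+ 2 - y^-1 + (y + 1)^-1.
  move=> y0.
  have le1 := laplaceable_expN _ laplaceable1.
  have leid := laplaceable_expN _ laplaceable_id.
  have lek2 := laplaceable_expN _ lk2.
  have : laplace (fun t => k2 t + -1 * (expR (- t) * k2 t)) y =
      laplace (fun t => (2^-1 * t + 2^-1 * (expR (- t) * t)) +
                        (-1 * 1 + expR (- t) * 1)) y.
    apply: eq_laplace => t t0; rewrite /k2 /k1 /binet_kernel expRN.
    by field; rewrite !gt_eqF ?expR_gt0 ?expRB1_gt0.
  have l1 := laplaceable1; have lid := laplaceable_id.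
  have lN1 := laplaceableZ (-1) _ l1; have lNk := laplaceableZ (-1) _ lek2.
  have lh := laplaceableZ 2^-1 _ lid; have lhe := laplaceableZ 2^-1 _ leid.
  have lA := laplaceableD _ _ lh lhe; have lB := laplaceableD _ _ lN1 le1.
  rewrite (laplaceD _ _ _ lk2 lNk)// (laplaceD _ _ _ lA lB)//.
  rewrite (laplaceD _ _ _ lh lhe)// (laplaceD _ _ _ lN1 le1)// !laplaceZ//.
  rewrite -!laplace_shift !laplace1 ?laplace_id ?Sgt0// mulN1r mulN1r => ->.
  ring.
have dG (y : R) : 0 < y -> is_derive y 1 gudermann (G1 y).
  move=> y0; have y1 := Sgt0 _ y0; rewrite /gudermann /G1; derive_fun; rewrite //=.
  by field; rewrite !gt_eqF.
have dG1 (y : R) : 0 < y -> is_derive y 1 G1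
    (2^-1 / y ^+ 2 + 2^-1 / (y + 1) ^+ 2 - y^-1 + (y + 1)^-1).
  move=> y0; have y1 := Sgt0 _ y0; rewrite /G1; derive_fun; rewrite /= ?gt_eqF//.
  by field; rewrite !gt_eqF.
have cvgB0 f y : laplaceable f -> 0 < y ->
    laplace f (y + n%:R) - laplace f (y + n%:R + 1) @[n --> \oo] --> (0 : R).
  move=> lf y0; rewrite -[X in _ --> X](subr0 0).
  apply: cvgB; first exact: laplace_shift_cvg0.
  under eq_fun do rewrite addrAC.
  by apply: laplace_shift_cvg0 => //; exact: Sgt0.
pose H1 y := - laplace k1 y + laplace k1 (y + 1) - G1 y.
have H1E : forall y, 0 < y -> H1 y = 0.
  apply: derive0_vanish => y y0.
    have dk := dA _ _ lk1 y0; have dg := dG1 _ y0.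
    have e : H1 = fun y => - (laplace k1 y - laplace k1 (y + 1)) - G1 y.
      by apply/funext => z; rewrite /H1; ring.
    rewrite e; derive_fun; rewrite -(k2E _ y0) /=; ring.
  have -> : (fun n => H1 (y + n%:R)) = (fun n => - (laplace k1 (y + n%:R)
      - laplace k1 (y + n%:R + 1)) - G1 (y + n%:R)).
    by apply/funext => n; rewrite /H1; ring.
  rewrite -[X in _ --> X](subr0 0) -[X in X - _]oppr0.
  apply: cvgB; first by apply: cvgN; exact: cvgB0.
  apply: (@le_inv_cvg_shift0 _ _ 1) => // z z0.
  have /andP[] := lnD1_bounds z z0; have z1 := Sgt0 _ z0.
  have : (z + 1)^-1 <= z^-1 by rewrite lef_pV2 ?posrE// lerDl.
  have : 0 < (z + 1)^-1 by rewrite invr_gt0.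
  rewrite /G1 => *; apply/ler_normlP; split; lra.
move: x; suff HE : forall y, 0 < y -> laplace binet_kernel y -
    laplace binet_kernel (y + 1) - gudermann y = 0.
  by move=> x /HE /eqP; rewrite subr_eq0 => /eqP.
apply: derive0_vanish => y y0.
  have dk := dA _ _ laplaceable_binet_kernel y0; have dg := dG _ y0.
  by derive_fun; exact: H1E.
rewrite -[X in _ --> X](subr0 0); apply: cvgB.
  exact: cvgB0 laplaceable_binet_kernel y0.
apply: (@le_inv_cvg_shift0 _ _ 2^-1) => // z z0.
have /andP[h1 h2] := lnD1_bounds z z0; have z1 := Sgt0 _ z0.
have z2 : 0 < z + 2^-1 by lra.
have {}h1 := ler_wpM2l (ltW z2) h1; have {}h2 := ler_wpM2l (ltW z2) h2.
have e1 : (z + 2^-1) * (z + 1)^-1 = 1 - 2^-1 * (z + 1)^-1.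
  by field; rewrite gt_eqF.
have e2 : (z + 2^-1) * z^-1 = 1 + 2^-1 * z^-1 by field; rewrite gt_eqF.
have : (z + 1)^-1 <= z^-1 by rewrite lef_pV2 ?posrE// lerDl.
rewrite /gudermann => h3; apply/ler_normlP; split; lra.
Qed.

End binet_integral.

(** * The Gamma function and the Stirling ratio *)

Section gamma.
Context {R : realType}.
Implicit Types (t x y : R).
Notation mu := (@lebesgue_measure R).
Notation D := (`]0, +oo[%classic : set R).

(** With [s = x * t / y] this is [s `^ y <= expR (y * s)], that is,
    [ln s <= s]. *)
Lemma powR_le_expR x y t : 0 < x -> 0 < y -> 0 < t ->
  t `^ y <= (y / x) `^ y * expR (x * t).
Proof.
move=> x0 y0 t0; have yx : 0 < y / x by rewrite divr_gt0.
have -> : t `^ y = (y / x) `^ y * (x * t / y) `^ y.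
  rewrite -powRM ?ltW//; last by rewrite divr_gt0 ?mulr_gt0.
  by congr powR; field; rewrite !gt_eqF.
rewrite ler_wpM2l ?powR_ge0//.
have xty : 0 < x * t / y by rewrite divr_gt0 ?mulr_gt0.
rewrite /powR gt_eqF// ler_expR.
have -> : x * t = y * (x * t / y) by field; rewrite gt_eqF.
rewrite ler_wpM2l ?(ltW y0)//.
have -> : y * (x * t / y) / y = x * t / y by field; rewrite gt_eqF.
exact: ltW (ln_sublinear xty).
Qed.

Lemma powR_continuous y t : 0 < t -> {for t, continuous (fun t => t `^ y)}.
Proof.
move=> t0; exact: (@is_derive_continuous R _ t _ (is_derive1_powR y t0)).
Qed.

Lemma laplaceable_powR y : 0 < y -> laplaceable (fun t => t `^ y).
Proof.
move=> y0; have mp : measurable_fun D (fun t => t `^ y).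
  by apply: gt0_continuous_measurable => t; exact: powR_continuous.
split=> // x x0; have x2 : 0 < x / 2 by rewrite divr_gt0.
have [_ l1] := laplaceableZ ((y / (x / 2)) `^ y) _ (@laplaceable1 R).
apply: (integrable_exp_le _ _ x (x / 2) mp _ (l1 _ x2)) => t t0.
rewrite mulr1 !ger0_norm ?mulr_ge0 ?expR_ge0 ?powR_ge0//.
have -> : - (x / 2 * t) = x / 2 * t - x * t by field.
by rewrite expRD mulrA ler_wpM2r ?expR_ge0// powR_le_expR.
Qed.

Lemma GammaE y : Gamma (y + 1) = laplace (fun t => t `^ y) 1.
Proof. by apply: eq_Rintegral => t _; rewrite mul1r addrK. Qed.

Lemma Gamma_gt0 y : 0 < y -> 0 < Gamma (y + 1).
Proof.
move=> y0; rewrite GammaE.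
apply: laplace_gt0 => //; first exact: laplaceable_powR.
by move=> t t0; rewrite powR_gt0.
Qed.

(** Integration by parts, as the vanishing of the integral of the derivative
    of [- t `^ (y + 1) * expR (- t)] over the half-line. *)
Lemma GammaS y : 0 < y -> Gamma (y + 1 + 1) = (y + 1) * Gamma (y + 1).
Proof.
move=> y0; have y1 : 0 < y + 1 by rewrite addr_gt0.
rewrite !GammaE.
pose F t := - (t `^ (y + 1) * expR (- (1 * t))).
pose f t := (t `^ (y + 1) + - (y + 1) * t `^ y) * expR (- (1 * t)).
have lp1 := laplaceable_powR (y + 1) y1; have lp := laplaceable_powR y y0.
have lpN := laplaceableZ (- (y + 1)) _ lp.
have [_ lf] := laplaceableD _ _ lp1 lpN.
suff : \int[mu]_(t in D) f t = 0 - 0.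
  rewrite -/(laplace (fun t => t `^ (y + 1) + - (y + 1) * t `^ y) 1).
  rewrite (laplaceD _ _ _ lp1 lpN)// laplaceZ// => h; lra.
apply: (@Rintegral_primitive R f F).
- move=> t t0; apply: cvgM; last first.
    exact: expRNM_continuous.
  apply: cvgD; first exact: powR_continuous.
  by apply: cvgMl_tmp; exact: powR_continuous.
- move=> t t0; have dp := is_derive1_powR (y + 1) t0.
  rewrite addrK in dp; rewrite /F /f.
  have dp' : is_derive t 1 (fun t => t `^ (y + 1)) ((y + 1) * t `^ y) := dp.
  by derive_fun; rewrite /=; ring.
- exact: lf.
- rewrite -[X in _ --> X]oppr0; apply: cvgN.
  rewrite -[X in _ --> X](mul0r 1).
  by apply: cvgM; [exact: (powR_cvg0 y1)|exact: expRNM_cvg0].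
- apply/norm_cvg0P.
  (* Half of the exponential absorbs the power. *)
  pose C := ((y + 1) / 2^-1) `^ (y + 1).
  apply: (@squeeze_cvgr _ _ _ _ (cst 0) (fun t => C * expR (- (2^-1 * t)))).
  + near=> t; have t0 : 0 < t by near: t; exact: nbhs_pinfty_gt.
    rewrite normr_ge0/= normrN ger0_norm ?mulr_ge0 ?expR_ge0 ?powR_ge0//.
    have -> : - (2^-1 * t) = 2^-1 * t - 1 * t by field.
    by rewrite expRD mulrA ler_wpM2r ?expR_ge0// powR_le_expR.
  + exact: cvg_cst.
  + by rewrite -[X in _ --> X](mulr0 C); apply: cvgMl_tmp; exact: expRNM_cvgy.
Unshelve. all: end_near. Qed.

Definition stirling_ratio x :=
  Gamma (x + 1) / (Num.sqrt (2 * pi * x) * (x / expR 1) `^ x).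

Lemma stirling_denom_gt0 x : 0 < x ->
  0 < Num.sqrt (2 * pi * x) * (x / expR 1) `^ x.
Proof.
move=> x0; rewrite mulr_gt0 ?powR_gt0 ?divr_gt0 ?expR_gt0// sqrtr_gt0.
by rewrite !mulr_gt0 ?pi_gt0.
Qed.

Lemma ln_stirling_ratioB x : 0 < x ->
  ln (stirling_ratio x) - ln (stirling_ratio (x + 1)) = gudermann x.
Proof.
have lnE y : 0 < y -> ln (stirling_ratio y) =
    ln (Gamma (y + 1)) - (2^-1 * (ln (2 * pi) + ln y) + y * (ln y - 1)).
  move=> y0; have pi2 : 0 < 2 * pi :> R by rewrite mulr_gt0 ?pi_gt0.
  have s0 : 0 < Num.sqrt (2 * pi * y) by rewrite sqrtr_gt0 mulr_gt0.
  have p0 : 0 < (y / expR 1) `^ y by rewrite powR_gt0 ?divr_gt0 ?expR_gt0.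
  rewrite /stirling_ratio ln_div ?posrE ?Gamma_gt0 ?stirling_denom_gt0//.
  have lM (a b : R) : 0 < a -> 0 < b -> ln (a * b) = ln a + ln b.
    by move=> a0 b0; rewrite lnM ?posrE.
  rewrite (lM _ _ s0 p0) ln_powR ln_div ?posrE ?expR_gt0// expRK.
  have -> : Num.sqrt (2 * pi * y) = (2 * pi * y) `^ 2^-1.
    by rewrite powR12_sqrt// ltW// mulr_gt0.
  by rewrite ln_powR (lM _ _ pi2 y0).
move=> x0; have x1 : 0 < x + 1 by rewrite addr_gt0.
have lnG : ln ((x + 1) * Gamma (x + 1)) = ln (x + 1) + ln (Gamma (x + 1)).
  by rewrite lnM ?posrE ?Gamma_gt0.
by rewrite !lnE// GammaS// lnG /gudermann; field.
Qed.

End gamma.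

(** * Stirling's formula by Laplace's method *)

Section stirling.
Context {R : realType}.
Implicit Types (t u v x y r : R).
Notation mu := (@lebesgue_measure R).
Notation D := (`]0, +oo[%classic : set R).

Lemma ln1DB_le_pos v : 0 < v -> ln (1 + v) - v <= - (v ^+ 2 / (2 * (1 + v))).
Proof.
move=> v0; rewrite -subr_ge0; apply: ltW; move: v v0.
apply: (@gt0_derive_gt0 R _ (fun v => v ^+ 2 / (2 * (1 + v) ^+ 2))).
- by rewrite addr0 ln1; lra.
- move=> v v0; have v1 : 0 < 1 + v by rewrite ltr_wpDr.
  derive_fun; rewrite /= ?gt_eqF ?mulr_gt0//.
  by field; rewrite gt_eqF.
- by move=> v v0; rewrite divr_gt0 ?exprn_gt0 ?mulr_gt0 ?exprn_gt0 ?addr_gt0.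
Qed.

Lemma ln1DB_le_neg v : -1 < v -> v < 0 -> ln (1 + v) - v <= - (v ^+ 2 / 2).
Proof.
move=> v1 v0; rewrite -subr_le0 opprK.
have := @gt0_derive_lt R (fun v => ln (1 + v) - v + v ^+ 2 / 2)
  (fun v => v ^+ 2 / (1 + v)) v 0 v0.
rewrite addr0 ln1 subrr expr0n/= mul0r addr0 => h; apply: ltW; apply: h.
- move=> w /andP[vw w0]; have w1 : 0 < 1 + w by lra.
  derive_fun => //=; by field; rewrite gt_eqF.
- move=> w /andP[vw w0]; have w1 : 0 < 1 + w by lra.
  by rewrite divr_gt0// exprn_even_gt0//= lt_eqF.
Qed.

(** By the mean value theorem, the expression inside the absolute value is
    [c ^+ 2 / (1 + c) * v] for some [c] between 0 and [v], and
    [1 + c >= 1 / 2]. *)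
Lemma ln1DB_approx v : `|v| <= 2^-1 ->
  `|ln (1 + v) - v + v ^+ 2 / 2| <= 2 * `|v| ^+ 3.
Proof.
move=> v2; have [->|v0] := eqVneq v 0.
  by rewrite addr0 ln1 subrr expr0n/= mul0r addr0 !normr0 mulr_ge0.
pose d w : R := w ^+ 2 / (1 + w).
pose f w : R := ln (1 + w) - w + w ^+ 2 / 2.
have fd (w : R) : `|w| <= `|v| -> is_derive w 1 f (d w).
  move=> wv; have /ler_normlP[w1 w2] := le_trans wv v2.
  have w0 : 0 < 1 + w by lra.
  by rewrite /f /d; derive_fun => //=; field; rewrite gt_eqF.
have f0 : f 0 = 0 by rewrite /f addr0 ln1 subrr expr0n/= mul0r addr0.
have [c cv fE] : exists2 c, `|c| <= `|v| & f v = d c * v.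
  have [v_lt|v_gt|v_eq] := ltgtP v 0; last by rewrite v_eq eqxx in v0.
  - have [|c /andP[vc c0]] := @mean_value R f d v 0 v_lt.
      move=> w /andP[vw w0]; apply: fd.
      by rewrite (ltr0_norm v_lt) ler0_norm// lerN2.
    rewrite f0 => e; exists c; last by lra.
    by rewrite (ltr0_norm v_lt) ler0_norm ?lerN2 ?ltW.
  - have [|c /andP[c0 cv]] := @mean_value R f d 0 v v_gt.
      by move=> w /andP[w0 wv]; apply: fd; rewrite (gtr0_norm v_gt) ger0_norm.
    rewrite f0 => e; exists c; last by lra.
    by rewrite (gtr0_norm v_gt) ger0_norm ?ltW.
rewrite -/(f v) fE normrM exprSr mulrA ler_wpM2r//.
have /ler_normlP[c1 c2] := le_trans cv v2.
have c0 : 0 < 1 + c by lra.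
rewrite /d normrM normfV (gtr0_norm c0) ler_pdivrMr// normrX.
have : `|c| ^+ 2 <= `|v| ^+ 2 by rewrite lerXn2r ?nnegrE.
have : 0 <= `|v| ^+ 2 by rewrite sqr_ge0.
have : 2^-1 <= 1 + c by lra.
by nra.
Qed.

(** The integrand of Euler's integral for [Gamma (y + 1)], normalized by its
    maximum, in the variable [u = (t - y) / Num.sqrt y] and with
    [r = 1 / Num.sqrt y]. The value 0 covers the points [u] for which
    [t <= 0]. *)
Definition stirling_integrand r u : R :=
  if 0 < 1 + r * u then expR ((ln (1 + r * u) - r * u) / r ^+ 2) else 0.

(** The exponent is about [- u ^+ 2 / 2] for small [r * u], but only about
    [- u / r] for large positive ones: a linear decay is the best that is
    uniform in [r]. *)
Lemma stirling_exponent_le r u : 0 < r <= 1 -> 0 < 1 + r * u ->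
  (ln (1 + r * u) - r * u) / r ^+ 2 <= (1 - `|u|) / 4.
Proof.
move=> /andP[r0 r1] ru; rewrite ler_pdivrMr ?exprn_gt0//.
have [u0|u0|->] := ltgtP u 0.
- have v0 : r * u < 0 by rewrite nmulr_llt0.
  apply: le_trans (ln1DB_le_neg _ _ v0) _; first by lra.
  rewrite (ltr0_norm u0) exprMn -subr_ge0.
  have -> : (1 - - u) / 4 * r ^+ 2 - - (r ^+ 2 * u ^+ 2 / 2) =
    r ^+ 2 * (u ^+ 2 / 2 + u / 4 + 4^-1) by field.
  by rewrite mulr_ge0 ?sqr_ge0//; have := sqr_ge0 (u + 2^-1); nra.
- have v0 : 0 < r * u by rewrite mulr_gt0.
  apply: le_trans (ln1DB_le_pos _ v0) _.
  rewrite (gtr0_norm u0) exprMn -subr_ge0.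
  have -> : (1 - u) / 4 * r ^+ 2 - - (r ^+ 2 * u ^+ 2 / (2 * (1 + r * u))) =
    r ^+ 2 * ((1 - r) * (u ^+ 2 - u) + u ^+ 2 + 1) / (4 * (1 + r * u)).
    by field; rewrite gt_eqF.
  rewrite divr_ge0 ?mulr_ge0 ?sqr_ge0 ?(ltW ru) ?(ltW r0)//.
  have h1 := sqr_ge0 (u - 2^-1).
  have h2 : 0 <= (1 - r) * (u - 2^-1) ^+ 2 by rewrite mulr_ge0// subr_ge0.
  have h3 := sqr_ge0 u; nra.
- by rewrite mulr0 addr0 ln1 subr0 normr0; have := sqr_ge0 r; lra.
Qed.

Lemma stirling_integrand_ge0 r u : 0 <= stirling_integrand r u.
Proof. by rewrite /stirling_integrand; case: ifP => // _; exact: expR_ge0. Qed.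

Lemma stirling_integrand_le r u : 0 < r <= 1 ->
  stirling_integrand r u <= expR ((1 - `|u|) / 4).
Proof.
move=> r01; rewrite /stirling_integrand.
case: ifP => [ru|_]; last exact: expR_ge0.
by rewrite ler_expR stirling_exponent_le.
Qed.

Lemma measurable_stirling_integrand r :
  measurable_fun setT (stirling_integrand r).
Proof.
have mru : measurable_fun setT (fun u => 1 + r * u).
  by apply: measurable_funD => //; exact: measurable_funM.
apply: measurable_fun_ifT => //.
- exact: measurable_fun_ltr.
- apply: measurableT_comp => //; apply: measurable_funM => //.
  apply: measurable_funB; last exact: measurable_funM.
  by apply: measurableT_comp mru; exact: measurable_ln.
Qed.

Lemma integrable_stirling_bound :
  mu.-integrable setT (fun u => (expR ((1 - `|u|) / 4))%:E).
Proof.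
have cf : continuous (fun u => expR ((1 - `|u|) / 4)).
  move=> u; apply: continuous_comp; last exact: continuous_expR.
  apply: cvgMr_tmp; apply: cvgB; first exact: cvg_cst.
  exact: norm_continuous.
have mf := continuous_measurable_fun cf.
apply/integrableP; split; first exact/measurable_EFinP.
under eq_integral do rewrite /= ger0_norm ?expR_ge0//.
rewrite ge0_symfun_integralT//.
- rewrite (_ : [set x | _] = `[0, +oo[%classic); last first.
    by apply/seteqP; split => x/=; rewrite in_itv/= andbT.
  rewrite -integral_itv_obnd_cbnd; last first.
    by apply: measurable_funTS; exact/measurable_EFinP.
  have [_ l1] := laplaceableZ (expR 4^-1) _ (@laplaceable1 R).
  have q0 : 0 < 4^-1 :> R by [].
  rewrite lte_mul_pinfty//.
  have /integrableP[_] := l1 _ q0; apply: le_lt_trans.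
  rewrite le_eqVlt; apply/orP; left; apply/eqP.
  apply: eq_integral => t; rewrite inE/= in_itv/= andbT => t0.
  rewrite mulr1 -expRD (gtr0_norm t0) ger0_norm ?expR_ge0//.
  by congr (expR _)%:E; field.
- by move=> u; rewrite /= normrN.
Qed.

Lemma cvg_stirling_integrand (r : nat -> R) u :
  (forall n, 0 < r n) -> r n @[n --> \oo] --> (0 : R) ->
  stirling_integrand (r n) u @[n --> \oo] --> expR (- (u ^+ 2 / 2)).
Proof.
move=> r0 rcvg.
have ru0 : r n * u @[n --> \oo] --> (0 : R).
  by rewrite -[X in _ --> X](mul0r u); exact: cvgMr_tmp.
have ru2 : \forall n \near \oo, `|r n * u| <= 2^-1.
  by apply: cvgr0_norm_le => //; exact: ru0.
have ecvg : (ln (1 + r n * u) - r n * u) / r n ^+ 2 @[n --> \oo]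
    --> - (u ^+ 2 / 2).
  apply/subr_cvg0; rewrite -[X in X @ _]/(fun n => _).
  apply/norm_cvg0P.
  apply: (@squeeze_cvgr _ _ _ _ (cst 0) (fun n => 2 * `|u| ^+ 3 * r n)).
  - near=> n; rewrite normr_ge0/=.
    have h := ln1DB_approx (r n * u); have rn := r0 n.
    have -> : (ln (1 + r n * u) - r n * u) / r n ^+ 2 - - (u ^+ 2 / 2) =
      (ln (1 + r n * u) - r n * u + (r n * u) ^+ 2 / 2) / r n ^+ 2.
      by field; rewrite gt_eqF.
    rewrite normrM normfV [`|r n ^+ 2|]ger0_norm ?sqr_ge0//.
    rewrite ler_pdivrMr ?exprn_gt0//.
    apply: le_trans (h _) _; first by near: n.
    rewrite normrM (gtr0_norm rn) exprMn.
    by rewrite le_eqVlt; apply/orP; left; apply/eqP; ring.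
  - exact: cvg_cst.
  - by rewrite -[X in _ --> X](mulr0 (2 * `|u| ^+ 3)); exact: cvgMl_tmp.
have expcvg : expR ((ln (1 + r n * u) - r n * u) / r n ^+ 2) @[n --> \oo]
    --> expR (- (u ^+ 2 / 2)).
  by apply: continuous_cvg ecvg; exact: continuous_expR.
apply: cvg_trans expcvg; apply: near_eq_cvg; near=> n.
rewrite /stirling_integrand ifT//.
have : `|r n * u| <= 2^-1 by near: n.
by move/ler_normlP => [? ?]; lra.
Unshelve. all: end_near. Qed.

Lemma integrable_stirling_integrand r : 0 < r <= 1 ->
  mu.-integrable setT (fun u => (stirling_integrand r u)%:E).
Proof.
move=> r01; apply: le_integrable integrable_stirling_bound => //.
  by apply/measurable_EFinP; exact: measurable_stirling_integrand.
move=> u _; rewrite lee_fin ger0_norm ?stirling_integrand_ge0//.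
by rewrite [leRHS]ger0_norm ?expR_ge0// stirling_integrand_le.
Qed.

Lemma Gamma_integrand_substitution s u : 0 < s -> - s <= u ->
  (s ^+ 2 + s * u) `^ (s ^+ 2) * expR (- (s ^+ 2 + s * u)) * s =
  s * (s ^+ 2 / expR 1) `^ (s ^+ 2) * stirling_integrand s^-1 u.
Proof.
move=> s0 su; have y0 : 0 < s ^+ 2 by rewrite exprn_gt0.
have wE : s ^+ 2 + s * u = s ^+ 2 * (1 + s^-1 * u) by field; rewrite gt_eqF.
rewrite /stirling_integrand; case: ltP => [w0|w0].
  have ye : 0 < s ^+ 2 / expR 1 by rewrite divr_gt0 ?expR_gt0.
  have yw : 0 < s ^+ 2 * (1 + s^-1 * u) by rewrite mulr_gt0.
  have lnyw : ln (s ^+ 2 * (1 + s^-1 * u)) = ln (s ^+ 2) + ln (1 + s^-1 * u).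
    by rewrite lnM ?posrE.
  rewrite wE /powR !gt_eqF// lnyw ln_div ?posrE ?expR_gt0// expRK.
  rewrite -expRD mulrC -mulrA -expRD; congr (_ * expR _).
  by field; rewrite gt_eqF.
have -> : s ^+ 2 + s * u = 0.
  apply/eqP; rewrite eq_le wE pmulr_rle0// w0/= -wE.
  by rewrite expr2 -mulrDr mulr_ge0 ?(ltW s0)// addrC -lerBlDr sub0r.
by rewrite powR0 ?gt_eqF// !mul0r mulr0.
Qed.

(** The substitution [t = y + Num.sqrt y * u]. The factor [normal_peak 1], which
    is [1 / Num.sqrt (2 * pi)], makes the limit of the integrand the standard
    normal density. *)
Lemma stirling_ratio_integral y : 1 <= y ->
  stirling_ratio y =
  \int[mu]_(u in setT) (normal_peak 1 * stirling_integrand (Num.sqrt y)^-1 u).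
Proof.
move=> y1; have y0 : 0 < y by exact: lt_le_trans y1.
set s := Num.sqrt y.
have s0 : 0 < s by rewrite sqrtr_gt0.
have sE : s ^+ 2 = y by rewrite sqr_sqrtr// ltW.
have s1 : 1 <= s by rewrite /s -[leLHS]sqrtr1 ler_sqrt// ltW.
have r01 : 0 < s^-1 <= 1 by rewrite invr_gt0 s0 invf_le1.
set K := s * (y / expR 1) `^ y.
have K0 : 0 < K by rewrite mulr_gt0 ?powR_gt0 ?divr_gt0 ?expR_gt0.
pose G t := t `^ y * expR (- (1 * t)).
pose F u := y + s * u.
have dF u : is_derive u 1 F s by rewrite /F; derive_fun; rewrite /=; ring.
have F'E : F^`()%classic = cst s.
  by apply/funext => u; rewrite derive1E; have [_ ->] := dF u.
have F0 : F (- s) = 0 by rewrite /F -sE; ring.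
have GcD t : 0 < t -> {for t, continuous G}.
  by move=> t0; apply: cvgM; [exact: powR_continuous|exact: expRNM_continuous].
have Gc : {within `[0, +oo[, continuous G}.
  apply/continuous_within_itvcyP; split.
    by move=> t; rewrite in_itv/= andbT; exact: GcD.
  rewrite /G powR0 ?gt_eqF// mul0r -[X in _ --> X](mul0r 1).
  by apply: cvgM; [exact: powR_cvg0|exact: expRNM_cvg0].
have sub : (\int[mu]_(t in `[0%R, +oo[) (G t)%:E =
    \int[mu]_(u in `[(- s)%R, +oo[) (K * stirling_integrand s^-1 u)%:E)%E.
  have := @increasing_ge0_integration_by_substitutiony R F G (- s).
  rewrite F0 F'E => ->//.
  - apply: eq_integral => u; rewrite inE/= in_itv/= andbT => su.
    congr EFin; have := Gamma_integrand_substitution s u s0 su.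
    by rewrite sE -[X in expR (- X)]mul1r.
  - by move=> a b _ _ ab; rewrite /F ltrD2l ltr_pM2l.
  - by move=> u _; exact: cst_continuous.
  - exact: is_cvg_cst.
  - exact: is_cvg_cst.
  - split=> [u _|]; first by have [] := dF u.
    by apply: cvg_at_right_filter; exact: is_derive_continuous (dF (- s)).
  - apply: (@cvg_comp _ _ _ (fun u => s * u) (fun z => y + z) _ +oo).
      exact: gt0_cvgMry.
    exact: cvg_addrl.
  - by move=> t _; rewrite /G mulr_ge0 ?powR_ge0 ?expR_ge0.
have iG : mu.-integrable D (EFin \o G).
  by have [_ lp] := laplaceable_powR y y0; exact: lp 1 ltr01.
have ih := integrable_stirling_integrand _ r01.
have GammaK : Gamma (y + 1) =
    \int[mu]_(u in setT) (K * stirling_integrand s^-1 u).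
  transitivity (\int[mu]_(t in D) G t).
    by apply: eq_Rintegral => t _; rewrite addrK /G mul1r.
  rewrite Rintegral_itv_obnd_cbnd//.
  transitivity (\int[mu]_(u in `[- s, +oo[) (K * stirling_integrand s^-1 u)).
    by rewrite /Rintegral sub.
  rewrite Rintegral_mkcond; apply: eq_Rintegral => u _.
  rewrite patchE; case: ifPn => // /negP.
  rewrite inE/= in_itv/= andbT => /negP; rewrite -ltNge => us.
  rewrite /stirling_integrand ifF ?mulr0//; apply/negbTE; rewrite -leNgt.
  have -> : 1 + s^-1 * u = s^-1 * (s + u) by field; rewrite gt_eqF.
  by rewrite pmulr_rle0 ?invr_gt0//; lra.
have KE : normal_peak 1 =
    (Num.sqrt (2 * pi * y) * (y / expR 1) `^ y)^-1 * K :> R.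
  rewrite /normal_peak /K expr1n mul1r -mulr_natl.
  have -> : Num.sqrt (2 * pi * y) = Num.sqrt (2 * pi) * s.
    by rewrite sqrtrM// mulr_ge0 ?pi_ge0.
  have p0 : 0 < (y / expR 1) `^ y by rewrite powR_gt0 ?divr_gt0 ?expR_gt0.
  have q0 : 0 < Num.sqrt (2 * pi) :> R by rewrite sqrtr_gt0 mulr_gt0 ?pi_gt0.
  by field; rewrite !gt_eqF.
rewrite /stirling_ratio GammaK KE.
rewrite RintegralZl// RintegralZl//.
by rewrite mulrC mulrA.
Qed.

Lemma cvg_stirling_ratio x : 1 <= x ->
  stirling_ratio (x + n%:R) @[n --> \oo] --> (1 : R).
Proof.
move=> x1; have x0 : 0 < x by exact: lt_le_trans x1.
have xn1 n : 1 <= x + n%:R by rewrite (le_trans x1)// lerDl.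
have xn0 n : 0 < x + n%:R by exact: lt_le_trans (xn1 n).
pose r n : R := (Num.sqrt (x + n%:R))^-1.
have r01 n : 0 < r n <= 1.
  rewrite /r invr_gt0 sqrtr_gt0 xn0/= invf_le1 ?sqrtr_gt0//.
  by rewrite -[leLHS]sqrtr1 ler_sqrt// ltW.
have r0 : r n @[n --> \oo] --> (0 : R).
  have h : Num.sqrt ((x + n%:R)^-1) @[n --> \oo] --> Num.sqrt (0 : R).
    apply: continuous_cvg; first exact: sqrt_continuous.
    apply: (@le_inv_cvg_shift0 _ (fun y => y^-1) 1 x x0) => y y0.
    by rewrite ger0_norm ?mul1r// invr_ge0 ltW.
  rewrite sqrtr0 in h; apply: cvg_trans h; apply: near_eq_cvg; near=> n.
  by rewrite sqrtrV// ltW.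
rewrite (_ : (fun n => _) = fun n =>
  \int[mu]_(u in setT) (normal_peak 1 * stirling_integrand (r n) u)); last first.
  by apply/funext => n; rewrite stirling_ratio_integral.
apply: fine_cvg.
rewrite -[X in _ --> X](integral_normal_pdf (0 : R) 1).
apply: (@dominated_cvg _ _ _ mu setT _ _ _
  (fun u => (normal_peak 1)%:E * (expR ((1 - `|u|) / 4))%:E)%E) => //.
- move=> n; apply/measurable_EFinP; apply: measurable_funM => //.
  exact: measurable_stirling_integrand.
- move=> u _; apply/cvg_EFin; first exact: nearW.
  rewrite normal_pdfE ?oner_neq0//; apply: cvgMl_tmp.
  have -> : normal_fun 0 1 u = expR (- (u ^+ 2 / 2)).
    by rewrite /normal_fun subr0 expr1n mulNr.
  by apply: cvg_stirling_integrand => // n; have /andP[] := r01 n.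
- by apply: integrableZl => //; exact: integrable_stirling_bound.
- move=> n u _; rewrite -EFinM lee_fin ger0_norm.
    by rewrite ler_wpM2l ?normal_peak_ge0 ?stirling_integrand_le.
  by rewrite mulr_ge0 ?normal_peak_ge0 ?stirling_integrand_ge0.
Unshelve. all: end_near. Qed.

End stirling.

(** * Complete monotonicity of theta *)

Section complete_monotonicity.
Context {R : realType}.
Implicit Types (f g : R -> R) (x y t : R).

Lemma laplaceable_moment f n : laplaceable f ->
  laplaceable (fun t => t ^+ n * f t).
Proof.
move=> lf; elim: n => [|n IHn].
  by apply: (eq_laplaceable f) => // t _; rewrite expr0 mul1r.
apply: eq_laplaceable (laplaceable_mulid _ IHn) => t _.
by rewrite exprS mulrA.
Qed.

(** The hypothesis compares [g] with the transform on the open half-line only;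
    this is enough to transfer all derivatives, since they are local. *)
Lemma derive1n_laplace f g n : laplaceable f ->
  (forall x, 0 < x -> g x = laplace f x) -> forall x, 0 < x ->
  g^`(n)%classic x = (-1) ^+ n * laplace (fun t => t ^+ n * f t) x /\
  derivable g^`(n)%classic x 1.
Proof.
move=> lf gf.
have step m y : 0 < y -> (forall z, 0 < z ->
      g^`(m)%classic z = (-1) ^+ m * laplace (fun t => t ^+ m * f t) z) ->
    is_derive y 1 g^`(m)%classic
      ((-1) ^+ m.+1 * laplace (fun t => t ^+ m.+1 * f t) y).
  move=> y0 gE.
  apply: (eq_gt0_is_derive
    (fun z => (-1) ^+ m * laplace (fun t => t ^+ m * f t) z)) => //.
    by move=> z z0; rewrite gE.
  have d := laplace_derive _ y (laplaceable_moment f m lf) y0.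
  have -> : laplace (fun t => t ^+ m.+1 * f t) y =
      laplace (fun t => t * (t ^+ m * f t)) y.
    by apply: eq_laplace => t _; rewrite exprS mulrA.
  by derive_fun; rewrite /= exprS; ring.
have gE m : forall z, 0 < z ->
    g^`(m)%classic z = (-1) ^+ m * laplace (fun t => t ^+ m * f t) z.
  elim: m => [|m IHm] z z0.
    by rewrite derive1n0 mul1r gf//; apply: eq_laplace => t _; rewrite mul1r.
  by rewrite derive1nS derive1E; have [_ ->] := step m z z0 IHm.
by move=> x x0; split; [exact: gE|have [] := step n x x0 (gE n)].
Qed.

(** Binet's formula. The difference of both sides is 1-periodic by their common
    difference equation, and tends to 0 along [x + n]. *)
Lemma ln_stirling_ratio x : 0 < x ->
  ln (stirling_ratio x) = laplace binet_kernel x.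
Proof.
pose d y := ln (stirling_ratio y) - laplace binet_kernel y.
move=> x0; apply/eqP; rewrite -subr_eq0 -/(d x); apply/eqP.
have dS (y : R) : 0 < y -> d (y + 1) = d y.
  move=> y0; have := ln_stirling_ratioB y y0.
  by rewrite -laplace_binet_kernelB// /d => h; lra.
(* The progression starts at [x + 1] to meet the hypothesis [1 <= x] of
   [cvg_stirling_ratio]. *)
have dn n : d (x + 1 + n%:R) = d x.
  elim: n => [|n IHn]; first by rewrite addr0 dS.
  by rewrite -natr1 addrA dS// ltr_wpDr// addr_gt0.
have x1 : 0 < x + 1 by rewrite addr_gt0.
have : d (x + 1 + n%:R) @[n --> \oo] --> ln 1 - 0.
  apply: cvgB; last exact: laplace_shift_cvg0 laplaceable_binet_kernel x1.
  apply: continuous_cvg; first exact: continuous_ln.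
  by apply: cvg_stirling_ratio; rewrite lerDr ltW.
under eq_fun do rewrite dn.
by move=> /(cvg_lim (@norm_hausdorff _ _)); rewrite lim_cst// ln1 subr0.
Qed.

(** Integration by parts produces the constant [12^-1], which cancels the 1 in
    the definition of [theta]. *)
Lemma theta_laplace x : 0 < x ->
  theta x = laplace (fun t => -12 * dbinet_kernel t) x.
Proof.
move=> x0; rewrite laplaceZ//; last exact: laplaceable_dbinet_kernel.
rewrite /theta /sigma -/(stirling_ratio x) ln_stirling_ratio//.
by have := laplace_binet_kernel_parts x x0; lra.
Qed.

End complete_monotonicity.

Theorem theorem2p3 (R : realType) (n : nat) (x : R) (hx : 0 < x) :
  derivable ((@theta R)^`(n)%classic) x 1 /\ 0 < (-1) ^+ n * ((@theta R)^`(n)%classic) x.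
Proof.
have lw := laplaceableZ (-12) _ (@laplaceable_dbinet_kernel R).
have [dE d] := derive1n_laplace _ _ n lw theta_laplace x hx.
split=> //; rewrite dE mulrA -exprMn mulrNN mulr1 expr1n mul1r.
apply: laplace_gt0 => //; first exact: laplaceable_moment.
move=> t t0; have := dbinet_kernel_lt0 t t0 => w0.
by rewrite mulr_gt0 ?exprn_gt0// nmulr_rgt0.
Qed.
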